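(* Let $(a,b)\in\mathbb{R}^2$ with $a<b$ and let $f\in L^1([a,b];\mathbb{R})$. Then $$\lim_{\alpha\to 0^+} \left\|J_a^\alpha f-f\right\|_{L^1([a,b];\mathbb{R})}=0.$$
   Context: The exponential-integral function is $E_1(x)=\int_x^\infty \frac{e^{-t}}{t}\,dt$ for $x>0$. For $\alpha>0$, $a<b$ real and $f\in L^1([a,b];\mathbb{R})$, the left-sided fractional integral of first kind of order $\alpha$ of $f$ is $$(J_a^\alpha f)(x)=\frac{1}{\alpha}\int_a^x E_1\left(\frac{x-t}{\alpha}\right)f(t)\,dt\quad\text{for a.e. } x\in[a,b].$$ *)

(* Defs.v *)
From HB Require Import structures.
From mathcomp Require Import all_boot all_order all_algebra.
From mathcomp Require Import all_classical all_reals all_analysis.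

Set Implicit Arguments.
Unset Strict Implicit.
Unset Printing Implicit Defensive.

Import Order.TTheory GRing.Theory Num.Theory.
Import numFieldNormedType.Exports.

Local Open Scope classical_set_scope.
Local Open Scope ring_scope.

(* Meaningful for x > 0 only: for x <= 0 the integral diverges and Rintegral
   returns the default value 0. *)
Definition E1 (R : realType) (x : R) : R :=
  \int[lebesgue_measure]_(t in `[x, +oo[) (expR (- t) / t).

(* The Lebesgue integral exists for a.e. x in [a, b] when f is integrable on
   [a, b] and 0 < alpha; where it does not, Rintegral returns an arbitrary
   value on a null set. The kernel's default value at t = x is likewise
   irrelevant. *)
Definition frac_int (R : realType) (a alpha : R) (f : R -> R) (x : R) : R :=
  alpha^-1 *
    \int[lebesgue_measure]_(t in `[a, x]) (E1 ((x - t) / alpha) * f t).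

(* Extended-real valued, so that convergence to 0 includes eventual finiteness.
   Functions on [a, b] are represented by functions on R whose values outside
   [a, b] are ignored. *)
Definition L1norm (R : realType) (a b : R) (g : R -> R) : \bar R :=
  'N[lebesgue_measure]_1[(EFin \o g) \_ `[a, b]]%E.

(* Main.v *)
Require Import Defs.
From mathcomp Require Import all_boot all_order all_algebra.
From mathcomp Require Import all_classical all_reals all_analysis.
From mathcomp Require Import measurable_realfun ring lra.
Import Order.TTheory GRing.Theory Num.Theory.
Import numFieldNormedType.Exports.
Local Open Scope classical_set_scope.
Local Open Scope ring_scope.

(** The kernel K(x, t) = E1((x - t) / alpha) / alpha (t < x) is an approximate
    identity: writing E1 as the integral of exp(-s) / s over s >= phi and using
    Tonelli, the integral of E1 o phi over D is that of
    exp(-s) / s * mu(D n {phi <= s}), so that K has mass 1 in x and in t, and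
    mass at most exp(-d / alpha) on {x - t >= d}.  Extend f by zero outside
    [a, b].  Because K has mass 1, |J f - f|(x) is at most the oscillation
    int K(x, t) |f(t) - f(x)| dt, an upper bound that only involves nonnegative
    integrals.  By Tonelli the L1 norm of this oscillation changes by at most
    2 |f - g|_1 when f is replaced by g; for g continuous on [a, b] it tends to
    0 by uniform continuity, the jump of the extension at a contributing only on
    [a, a + d].  Conclude by density of continuous functions in L1. *)

(* Unlike [ge0_le_integral], no measurability is assumed: it is not established
   for [frac_int]. *)
Lemma ge0_le_integral_nonmeas d (T : measurableType d) (R : realType)
    (mu : {measure set T -> \bar R}) (D : set T) (f g : T -> \bar R) :
  (forall x, D x -> (0 <= f x)%E) -> (forall x, D x -> (f x <= g x)%E) ->
  (\int[mu]_(x in D) f x <= \int[mu]_(x in D) g x)%E.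
Proof.
move=> f0 fg; rewrite integral_mkcond [leRHS]integral_mkcond.
have fD0 x : (0 <= (f \_ D) x)%E by apply: erestrict_ge0.
have fgD x : ((f \_ D) x <= (g \_ D) x)%E by apply: lee_restrict.
(* The integral of a nonnegative function is a supremum over the simple functions below it, and
   those below [f] are below [g]. *)
rewrite !ge0_integralTE//; last by move=> x; exact: le_trans (fD0 x) (fgD x).
apply: ereal_sup_le => _ [h hf <-]; exists h => // x.
exact: le_trans (hf x) (fgD x).
Qed.

(** * Integrals of exp(-s) *)

Lemma integral_expRN (R : realType) (y : R) :
  (\int[lebesgue_measure]_(s in `[y, +oo[) (expR (- s))%:E = (expR (- y))%:E)%E.
Proof.
have cexpN : continuous (fun z : R^o => expR (- z)).
  move=> z; apply: continuous_comp; last exact: continuous_expR.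
  exact: (@continuousN _ R^o).
rewrite (@ge0_continuous_FTC2y _ _ (fun x => - expR (- x)) _ 0)//.
- by rewrite EFinN oppeK add0e.
- exact: continuous_subspaceT.
- by rewrite -oppr0; apply: cvgN; exact: cvgr_expR.
- by apply: cvgN; apply/cvg_at_right_filter; exact: cexpN.
- move=> z _.
  rewrite derive1_comp// derive1N// derive1_id mulN1r derive1_comp// derive1E.
  have /funeqP -> := @derive_expR R.
  by rewrite derive1N// derive1_id mulrN1 opprK.
Qed.

Lemma measurable_expRN {R : realType} (D : set R) :
  measurable_fun D (fun s : R => (expR (- s))%:E).
Proof.
apply/measurable_EFinP; apply: measurable_funTS.
by apply: measurableT_comp => //.
Qed.

Lemma integralZl_expRN (R : realType) (D : set R) (k : R) :
  measurable D -> 0 <= k ->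
  (\int[lebesgue_measure]_(s in D) (k%:E * (expR (- s))%:E) =
   k%:E * \int[lebesgue_measure]_(s in D) (expR (- s))%:E)%E.
Proof.
by move=> mD k0; apply: ge0_integralZl => //; exact: measurable_expRN.
Qed.

(** * Integrals of [E1] composed with a function, by Tonelli *)

Section E1_kernel.
Context {R : realType}.
Notation mu := (@lebesgue_measure R).

(** Extension by zero to s <= 0 makes the integrand of [E1] nonnegative and measurable on the whole
    line, ready for Tonelli. *)
Definition E1_density : R -> R := (fun s => expR (- s) / s) \_ `]0, +oo[.

Lemma E1_density_gt0E s : 0 < s -> E1_density s = expR (- s) / s.
Proof. by move=> s0; rewrite /E1_density patchE mem_set//= in_itv/= s0. Qed.

Lemma E1_density_ge0 s : 0 <= E1_density s.
Proof.
apply: restrict_ge0 => {}s /=; rewrite in_itv/= andbT => /ltW s0.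
by rewrite divr_ge0 ?expR_ge0.
Qed.

Lemma measurable_E1_density : measurable_fun setT E1_density.
Proof.
apply/(measurable_restrictT _ _).1 => //.
apply: open_continuous_measurable_fun => // s.
rewrite inE/= in_itv/= andbT => s0.
apply: cvgM; last by apply: cvgV => //; rewrite gt_eqF.
apply: continuous_comp; last exact: continuous_expR.
exact: (@continuousN _ R^o).
Qed.

(** On [x, +oo[ the density is at most exp(-s) / x, so the integral is finite and the [fine] inside
    [Rintegral] loses nothing. *)
Lemma E1E (x : R) : 0 < x ->
  (\int[mu]_(s in `[x, +oo[) (E1_density s)%:E = (E1 x)%:E)%E.
Proof.
move=> x0; rewrite /E1 /Rintegral.
under [in RHS]eq_integral => s.
  rewrite inE/= in_itv/= andbT => xs.
  rewrite -E1_density_gt0E ?(lt_le_trans x0)//.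
  over.
rewrite fineK// ge0_fin_numE; last first.
  by apply: integral_ge0 => s _; rewrite lee_fin E1_density_ge0.
apply: (@le_lt_trans _ _
    (\int[mu]_(s in `[x, +oo[) (x^-1%:E * (expR (- s))%:E)))%E.
  apply: ge0_le_integral => //=.
  - by move=> s _; rewrite lee_fin E1_density_ge0.
  - apply/measurable_EFinP; apply: measurable_funTS.
    exact: measurable_E1_density.
  - by apply: measurable_funeM; exact: measurable_expRN.
  - move=> s; rewrite in_itv/= andbT => xs.
    have s0 := lt_le_trans x0 xs.
    rewrite lee_fin E1_density_gt0E// mulrC ler_wpM2r ?expR_ge0//.
    by rewrite lef_pV2.
rewrite integralZl_expRN//; last by rewrite invr_ge0 ltW.
by rewrite integral_expRN -EFinM ltry.
Qed.

Lemma E1_ge0 (x : R) : 0 < x -> 0 <= E1 x.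
Proof.
move=> x0; rewrite -lee_fin -E1E//; apply: integral_ge0 => s _.
by rewrite lee_fin E1_density_ge0.
Qed.

Section superlevel.
Variables (D : set R) (phi : R -> R).
Hypotheses (mD : measurable D) (mphi : measurable_fun setT phi).
Hypothesis phi_gt0 : forall x, D x -> 0 < phi x.

(** Domain of the double integral: its section at x in D is [phi x, +oo[, its section at s is D n
    {phi <= s}. *)
Let A : set (R * R) := [set p | D p.1 /\ phi p.1 <= p.2].

Let mA : measurable A.
Proof.
rewrite (_ : A = (fst @^-1` D) `&` ((fun p => p.2 - phi p.1) @^-1` `[0, +oo[)).
  apply: measurableI.
    by rewrite -[X in measurable X]setTI; exact: measurable_fst.
  rewrite -[X in measurable X]setTI.
  have : measurable_fun setT (fun p : R * R => p.2 - phi p.1).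
    apply: measurable_funB; first exact: measurable_snd.
    by apply: measurableT_comp => //; exact: measurable_fst.
  by apply.
by apply/seteqP; split => p /=; rewrite in_itv/= andbT subr_ge0.
Qed.

Let F (p : R * R) : \bar R := (E1_density p.2 * \1_A p)%:E.

Let F0 p : (0 <= F p)%E.
Proof. by rewrite lee_fin mulr_ge0 ?E1_density_ge0. Qed.

Let mF : measurable_fun setT F.
Proof.
apply/measurable_EFinP; apply: measurable_funM; last exact: measurable_indic.
by apply: measurableT_comp; [exact: measurable_E1_density|exact: measurable_snd].
Qed.

Let FE x : (\int[mu]_s F (x, s) = ((EFin \o (@E1 R \o phi)) \_ D) x)%E.
Proof.
rewrite patchE; case: ifPn => [|xD].
  rewrite inE => Dx; rewrite /= -E1E ?phi_gt0//.
  rewrite [RHS]integral_mkcond; apply: eq_integral => s _.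
  rewrite patchE /F indicE; case: ifPn => [|].
    by rewrite inE/= in_itv/= andbT => sx; rewrite mem_set ?mulr1.
  rewrite notin_setE/= in_itv/= andbT => sx; rewrite memNset ?mulr0//.
  by case.
apply: integral0_eq => s _; rewrite /F indicE memNset ?mulr0// => -[/=].
by rewrite notin_setE in xD.
Qed.

(** By [FE] this function is a partial integral of [F], hence measurable by Tonelli. *)
Lemma measurable_E1_comp : measurable_fun setT ((@E1 R \o phi) \_ D).
Proof.
apply/measurable_EFinP.
rewrite (_ : _ \o _ = fubini_F mu F).
  exact: measurable_fun_fubini_tonelli_F.
by apply/funext => x; rewrite /fubini_F FE restrict_EFin.
Qed.

Let mS s : measurable (D `&` [set x | phi x <= s]).
Proof.
apply: measurableI => //; rewrite -[X in measurable X]setTI.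
rewrite (_ : [set x | _] = phi @^-1` `]-oo, s]); first exact: mphi.
by apply/seteqP; split => x /=; rewrite in_itv.
Qed.

Lemma integral_E1_comp :
  (\int[mu]_(x in D) (E1 (phi x))%:E =
   \int[mu]_(s in `]0%R, +oo[)
     ((expR (- s) / s)%:E * mu (D `&` [set x | (phi x <= s)%R])))%E.
Proof.
rewrite integral_mkcond.
under eq_integral => x _ do rewrite -[_ x]FE.
rewrite fubini_tonelli// [RHS]integral_mkcond.
apply: eq_integral => s _; rewrite patchE; case: ifPn => [|s0].
  rewrite inE/= in_itv/= andbT => s0.
  rewrite -E1_density_gt0E// -[X in mu X]setIT -integral_indic//.
  rewrite -ge0_integralZl//; last by rewrite lee_fin E1_density_ge0.
  - by apply/measurable_EFinP; apply: measurable_indic; exact: mS.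
  - exact: mS.
apply: integral0_eq => x _; rewrite /F /E1_density patchE (negbTE s0).
by rewrite mul0r.
Qed.
End superlevel.
End E1_kernel.

(** * Mass and tails of the kernel *)

Section E1_kernel_mass.
Context {R : realType}.
Notation mu := (@lebesgue_measure R).

(** The factor s of the measure cancels the 1 / s of the density, which leaves al times the integral
    of exp(-s) over ]0, +oo[, equal to 1. *)
Lemma integral_E1_comp_mass (D : set R) (phi : R -> R) (al : R) :
  measurable D -> measurable_fun setT phi -> (forall x, D x -> 0 < phi x) ->
  0 <= al ->
  (forall s : R, 0 < s -> mu (D `&` [set x | phi x <= s]) = (al * s)%:E) ->
  (\int[mu]_(x in D) (E1 (phi x))%:E = al%:E)%E.
Proof.
move=> mD mphi phi0 al0 muD; rewrite integral_E1_comp//.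
transitivity (\int[mu]_(s in `]0%R, +oo[) (al%:E * (expR (- s))%:E))%E.
  apply: eq_integral => s; rewrite inE/= in_itv/= andbT => s0.
  by rewrite muD// -!EFinM; congr _%:E; field; rewrite gt_eqF.
rewrite integralZl_expRN// (integral_itv_obnd_cbnd (measurable_expRN _)).
by rewrite integral_expRN oppr0 expR0 mule1.
Qed.

(** Since phi >= y on D, the sets D n {phi <= s} with s < y are empty, and only the integral of
    exp(-s) over [y, +oo[ survives. *)
Lemma integral_E1_comp_tail (D : set R) (phi : R -> R) (al y : R) :
  measurable D -> measurable_fun setT phi -> (forall x, D x -> y <= phi x) ->
  0 <= al -> 0 < y ->
  (forall s : R, 0 < s -> (mu (D `&` [set x | phi x <= s]%R) <= (al * s)%:E)%E) ->
  (\int[mu]_(x in D) (E1 (phi x))%:E <= (al * expR (- y))%:E)%E.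
Proof.
move=> mD mphi phiy al0 y0 muD; rewrite integral_E1_comp//; last first.
  by move=> x /phiy; exact: lt_le_trans.
rewrite EFinM -integral_expRN -integralZl_expRN//.
rewrite integral_mkcond [leRHS]integral_mkcond.
apply: ge0_le_integral_nonmeas => s _.
  by apply: erestrict_ge0 => {}s /=; rewrite in_itv/= andbT => /ltW s0;
    rewrite mule_ge0// lee_fin divr_ge0 ?expR_ge0.
rewrite !patchE; case: ifPn => [|_]; last first.
  by case: ifPn => // _; rewrite mule_ge0 ?lee_fin ?expR_ge0.
rewrite inE/= in_itv/= andbT => s0; case: ifPn => [_|].
  apply: (@le_trans _ _ ((expR (- s) / s)%:E * (al * s)%:E))%E.
    by rewrite lee_wpmul2l ?muD// lee_fin divr_ge0 ?expR_ge0// ltW.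
  by rewrite -!EFinM lee_fin le_eqVlt; apply/orP; left; apply/eqP; field;
    rewrite gt_eqF.
rewrite notin_setE/= in_itv/= andbT => /negP; rewrite -ltNge => sy.
rewrite [X in mu X](_ : _ = set0) ?measure0 ?mule0//.
apply/seteqP; split => x //= -[/phiy yx xs].
by have := lt_le_trans sy (le_trans yx xs); rewrite ltxx.
Qed.

(** Cutting [E1] off at 0 makes the kernel vanish for t >= x, so that integrals up to x become
    integrals over the whole line. *)
Definition frac_kernel (al x t : R) : R :=
  al^-1 * (@E1 R \_ `]0, +oo[) ((x - t) / al).

Context {al : R}.
Hypothesis al0 : 0 < al.

Lemma frac_kernelE (x t : R) : t < x ->
  frac_kernel al x t = al^-1 * E1 ((x - t) / al).
Proof.
move=> tx; rewrite /frac_kernel patchE mem_set//= in_itv/= andbT.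
by rewrite divr_gt0// subr_gt0.
Qed.

Lemma frac_kernel0 (x t : R) : x <= t -> frac_kernel al x t = 0.
Proof.
move=> xt; rewrite /frac_kernel patchE memNset ?mulr0//= in_itv/= andbT.
by apply/negP; rewrite -leNgt ler_pdivrMr// mul0r subr_le0.
Qed.

Lemma frac_kernel_ge0 (x t : R) : 0 <= frac_kernel al x t.
Proof.
have [tx|xt] := ltP t x; last by rewrite frac_kernel0.
rewrite frac_kernelE// mulr_ge0 ?invr_ge0 ?(ltW al0)//.
by rewrite E1_ge0// divr_gt0// subr_gt0.
Qed.

Lemma measurable_frac_kernel :
  measurable_fun setT (fun p : R * R => frac_kernel al p.1 p.2).
Proof.
apply: measurable_funM => //.
apply: (@measurableT_comp _ _ _ _ _ _ (@E1 R \_ `]0, +oo[)).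
  apply: (@measurable_E1_comp _ `]0, +oo[ id) => //.
  by move=> x /=; rewrite in_itv/= andbT.
apply: measurable_funM => //; apply: measurable_funB.
  exact: measurable_fst.
exact: measurable_snd.
Qed.

Let mphi1 (x : R) : measurable_fun setT (fun t : R => (x - t) / al).
Proof. by apply: measurable_funM => //; exact: measurable_funB. Qed.

Let mphi2 (t : R) : measurable_fun setT (fun x : R => (x - t) / al).
Proof. by apply: measurable_funM => //; exact: measurable_funB. Qed.

Let kernelZ (D : set R) (phi k : R -> R) :
  measurable D -> measurable_fun setT phi -> (forall x, D x -> 0 < phi x) ->
  (forall x, D x -> k x = al^-1 * E1 (phi x)) ->
  (\int[mu]_(x in D) (k x)%:E = (al^-1)%:E * \int[mu]_(x in D) (E1 (phi x))%:E)%E.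
Proof.
move=> mD mphi phi0 kE; rewrite -ge0_integralZl//.
- by apply: eq_integral => x; rewrite inE => /kE ->; rewrite EFinM.
- apply/measurable_EFinP; apply: (iffRL (measurable_restrictT (@E1 R \o phi) mD)).
  exact: measurable_E1_comp.
- by move=> x /phi0 ?; rewrite lee_fin E1_ge0.
- by rewrite lee_fin invr_ge0 ltW.
Qed.

Lemma integral_frac_kernel_r (x : R) : (\int[mu]_t (frac_kernel al x t)%:E = 1)%E.
Proof.
transitivity (\int[mu]_(t in `]-oo, x[) (frac_kernel al x t)%:E)%E.
  rewrite [RHS]integral_mkcond; apply: eq_integral => t _.
  rewrite patchE; case: ifPn => //.
  rewrite notin_setE/= in_itv/= => /negP; rewrite -leNgt => xt.
  by rewrite frac_kernel0.
rewrite (@kernelZ _ (fun t => (x - t) / al))//.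
- rewrite (@integral_E1_comp_mass _ _ al)//.
  + by rewrite -EFinM mulVf// gt_eqF.
  + by move=> t; rewrite /= in_itv/= => tx; rewrite divr_gt0// subr_gt0.
  + exact: ltW.
  (* The points t < x with (x - t) / al <= s fill an interval of length al * s, as the mass lemma
     requires. *)
  + move=> s s0; rewrite (_ : _ `&` _ = `[x - al * s, x[%classic).
      rewrite lebesgue_measure_itv/= lte_fin ltrBlDr ltrDl mulr_gt0//.
      by rewrite -EFinB opprB addrC subrK.
    apply/seteqP; split => t /=; rewrite !in_itv/= ler_pdivrMr//.
      by move=> [-> h]; rewrite andbT; lra.
    by move=> /andP[h ->]; split => //; lra.
- by move=> t; rewrite /= in_itv/= => tx; rewrite divr_gt0// subr_gt0.
- by move=> t; rewrite /= in_itv/= => tx; rewrite frac_kernelE.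
Qed.

Lemma integral_frac_kernel_l (t : R) : (\int[mu]_x (frac_kernel al x t)%:E = 1)%E.
Proof.
transitivity (\int[mu]_(x in `]t, +oo[) (frac_kernel al x t)%:E)%E.
  rewrite [RHS]integral_mkcond; apply: eq_integral => x _.
  rewrite patchE; case: ifPn => //.
  rewrite notin_setE/= in_itv/= andbT => /negP; rewrite -leNgt => xt.
  by rewrite frac_kernel0.
rewrite (@kernelZ _ (fun x => (x - t) / al))//.
- rewrite (@integral_E1_comp_mass _ _ al)//.
  + by rewrite -EFinM mulVf// gt_eqF.
  + by move=> x; rewrite /= in_itv/= andbT => tx; rewrite divr_gt0// subr_gt0.
  + exact: ltW.
  + move=> s s0; rewrite (_ : _ `&` _ = `]t, t + al * s]%classic).
      rewrite lebesgue_measure_itv/= lte_fin ltrDl mulr_gt0//.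
      by rewrite -EFinB addrC addKr.
    apply/seteqP; split => x /=; rewrite !in_itv/= ler_pdivrMr//.
      by rewrite andbT => -[-> h]; lra.
    by move=> /andP[-> h]; split => //; lra.
- by move=> x; rewrite /= in_itv/= andbT => tx; rewrite divr_gt0// subr_gt0.
- by move=> x; rewrite /= in_itv/= andbT => tx; rewrite frac_kernelE.
Qed.

Lemma integral_frac_kernel_tail (x d : R) : 0 < d ->
  (\int[mu]_(t in `]-oo, (x - d)%R]) (frac_kernel al x t)%:E <=
   (expR (- (d / al)))%:E)%E.
Proof.
move=> d0.
have dphi t : `]-oo, x - d]%classic t -> d / al <= (x - t) / al.
  by rewrite /= in_itv/= => tx; rewrite ler_pM2r ?invr_gt0//; lra.
have phi0 t : `]-oo, x - d]%classic t -> 0 < (x - t) / al.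
  by move=> /dphi; apply: lt_le_trans; rewrite divr_gt0.
rewrite (@kernelZ _ (fun t => (x - t) / al))//.
- rewrite -[leRHS]mul1e -(@mulVf _ al) ?gt_eqF// EFinM -muleA.
  rewrite lee_wpmul2l ?lee_fin ?invr_ge0 ?(ltW al0)//.
  rewrite -EFinM; apply: integral_E1_comp_tail => //.
  + exact: ltW.
  + by rewrite divr_gt0.
  (* For a tail an upper bound on the measure is enough: the set lies in the interval of length al *
     s found for the full mass. *)
  + move=> s s0; apply: (@le_trans _ _ (mu `[x - al * s, x[%classic)).
      apply: le_measure; rewrite ?inE//; last first.
        move=> t /=; rewrite !in_itv/= ler_pdivrMr// => -[h1 h2]; lra.
      apply: measurableI => //; rewrite -[X in measurable X]setTI.
      rewrite (_ : [set t | _] = (fun t => (x - t) / al) @^-1` `]-oo, s]).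
        exact: mphi1.
      by apply/seteqP; split => t /=; rewrite in_itv.
    rewrite lebesgue_measure_itv/= lte_fin ltrBlDr ltrDl mulr_gt0//.
    by rewrite -EFinB opprB addrC subrK.
- move=> t /=; rewrite in_itv/= => tx; rewrite frac_kernelE//; lra.
Qed.
End E1_kernel_mass.

(** * The kernel oscillation dominates the pointwise error *)

Section frac_osc.
Context {R : realType}.
Notation mu := (@lebesgue_measure R).

(** The value +oo is allowed, so that the oscillation makes sense at every x, even where t |-> K(x,
    t) h(t) is not integrable. *)
Definition frac_osc (al : R) (h : R -> R) (x : R) : \bar R :=
  (\int[mu]_t (frac_kernel al x t * `|h t - h x|)%:E)%E.

Context {al : R}.
Hypothesis al0 : 0 < al.

Let K0 := frac_kernel_ge0 al0.

Let mK x : measurable_fun setT (frac_kernel al x).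
Proof. exact: (measurable_fun_pair2 x measurable_frac_kernel). Qed.

Let mKh (x : R) (h : R -> R) : measurable_fun setT h ->
  measurable_fun setT (fun t => (frac_kernel al x t * h t)%:E).
Proof. by move=> mh; apply/measurable_EFinP; exact: measurable_funM. Qed.

Lemma integral_frac_kernelZ (x c : R) : 0 <= c ->
  (\int[mu]_t (frac_kernel al x t * c)%:E = c%:E)%E.
Proof.
move=> c0; under eq_integral do rewrite EFinM.
rewrite ge0_integralZr//.
- by rewrite integral_frac_kernel_r// mul1e.
- by apply/measurable_EFinP; exact: mK.
- by move=> t _; rewrite lee_fin K0.
Qed.

Lemma frac_int_le_osc (a b : R) (f : R -> R) (x : R) :
  measurable_fun `[a, b] f -> a <= x <= b ->
  (`|frac_int a al f x - f x|%:E <= frac_osc al (f \_ `[a, b]) x)%E.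
Proof.
move=> mf /andP[ax xb].
set h := f \_ `[a, b].
have mh : measurable_fun setT h by apply: (iffLR (measurable_restrictT f _) mf).
have hx : h x = f x by rewrite /h patchE mem_set//= in_itv/= ax.
(* A finite oscillation forces t |-> K(x, t) h(t) to be integrable. *)
have [->|] := eqVneq (frac_osc al h x) +oo%E; first by rewrite leey.
rewrite -ltey => oscx.
have iK : mu.-integrable setT (EFin \o frac_kernel al x).
  apply/integrableP; split; first by apply/measurable_EFinP; exact: mK.
  under eq_integral do rewrite /= ger0_norm//.
  by rewrite integral_frac_kernel_r// ltry.
have iKx : mu.-integrable setT (fun t => (frac_kernel al x t * h x)%:E).
  have := integrableZr measurableT (h x) iK.
  by under [X in _.-integrable _ X]eq_fun do rewrite /= -EFinM.
have iKh : mu.-integrable setT (fun t => (frac_kernel al x t * h t)%:E).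
  apply/integrableP; split; first exact: mKh.
  (* |h(t)| <= |h(t) - h(x)| + |h(x)|: the first part is the finite oscillation, the second
     integrates to |h(x)| by mass 1. *)
  apply: (@le_lt_trans _ _ (\int[mu]_t ((frac_kernel al x t * `|h t - h x|)%:E +
      (frac_kernel al x t * `|h x|)%:E)))%E.
    apply: ge0_le_integral_nonmeas => t _ //=.
    rewrite lee_fin normrM ger0_norm// -mulrDr ler_wpM2l//.
    by rewrite -[X in `|X| <= _](subrK (h x)) ler_normD.
  rewrite ge0_integralD//.
  - by rewrite integral_frac_kernelZ// lte_add_pinfty// ltry.
  - by move=> t _; rewrite lee_fin mulr_ge0.
  - apply: mKh; apply: measurableT_comp => //; exact: measurable_funB.
  - by move=> t _; rewrite lee_fin mulr_ge0.
  - exact: mKh.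
have fracE : frac_int a al f x = \int[mu]_t (frac_kernel al x t * h t).
  transitivity (\int[mu]_(t in `[a, x[) (frac_kernel al x t * h t)); last first.
    (* Outside [a, x[ the integrand is zero: [h] vanishes for t < a, the kernel for t >= x. *)
    rewrite Rintegral_mkcond; apply: eq_Rintegral => t _.
    rewrite patchE; case: ifPn => //; rewrite notin_setE/= in_itv/= => /negP.
    rewrite negb_and -ltNge -leNgt => /orP[ta|xt].
    2: by rewrite frac_kernel0 ?mul0r.
    rewrite /h patchE memNset ?mulr0//= in_itv/= => /andP[at_ _].
    by move: ta; rewrite ltNge at_.
  have E1K t : t \in `[a, x[%classic ->
      E1 ((x - t) / al) * f t = al * (frac_kernel al x t * h t).
    rewrite inE/= in_itv/= => /andP[at_ tx]; rewrite frac_kernelE//.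
    rewrite /h patchE mem_set/= ?in_itv/= ?at_ ?(le_trans (ltW tx))//.
    by field; rewrite gt_eqF.
  have iKh' : mu.-integrable `[a, x[ (fun t => (frac_kernel al x t * h t)%:E).
    exact: integrableS iKh.
  (* At t = x the value [E1 0] is a mere default; this null endpoint is dropped so that [E1K]
     applies. *)
  rewrite /frac_int -Rintegral_itv_bndo_bndc; last first.
    apply: (@eq_integrable _ _ _ mu _ _
      (fun t : R => (al%:E * (frac_kernel al x t * h t)%:E)%E)) => //.
      by move=> t /E1K /= ->.
    exact: integrableZl.
  rewrite (@eq_Rintegral _ _ _ mu _
    (fun t => al * (frac_kernel al x t * h t)) _ E1K).
  by rewrite RintegralZl// mulrA mulVf ?mul1r// gt_eqF.
have fxE : f x = \int[mu]_t (frac_kernel al x t * h x).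
  rewrite RintegralZr//.
  by rewrite /Rintegral integral_frac_kernel_r// mul1r.
rewrite fracE {1}fxE -RintegralB//.
have iB : mu.-integrable setT
    (fun t => (frac_kernel al x t * h t - frac_kernel al x t * h x)%:E).
  have := integrableB measurableT iKh iKx.
  by under [X in _.-integrable _ X]eq_fun do rewrite -EFinB.
rewrite EFin_normr_Rintegral//.
apply: le_trans (le_abse_integral _ _ _) _ => //.
  exact: measurable_int iB.
apply: ge0_le_integral_nonmeas => t _ //.
by rewrite /= -mulrBr normrM ger0_norm.
Qed.

End frac_osc.

(** * Stability of the oscillation under L1 perturbation *)

Section frac_osc_approx.
Context {R : realType}.
Notation mu := (@lebesgue_measure R).
Context {al : R}.
Hypothesis al0 : 0 < al.

Let K0 := frac_kernel_ge0 al0.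

Let mK2 : measurable_fun setT (fun p : R * R => frac_kernel al p.1 p.2) :=
  @measurable_frac_kernel _ al.

Let mK x : measurable_fun setT (frac_kernel al x).
Proof. exact: (measurable_fun_pair2 x mK2). Qed.

Lemma measurable_frac_osc (h : R -> R) : measurable_fun setT h ->
  measurable_fun setT (frac_osc al h).
Proof.
move=> mh.
apply: (@measurable_fun_fubini_tonelli_F _ _ _ _ _ mu
  (fun p : R * R => (frac_kernel al p.1 p.2 * `|h p.2 - h p.1|)%:E)).
  apply/measurable_EFinP; apply: measurable_funM => //.
  apply: measurableT_comp => //; apply: measurable_funB;
    apply: measurableT_comp => //.
by move=> p; rewrite lee_fin mulr_ge0.
Qed.

Lemma frac_osc_ge0 (h : R -> R) (x : R) : (0 <= frac_osc al h x)%E.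
Proof. by apply: integral_ge0 => t _; rewrite lee_fin mulr_ge0. Qed.

Let conv (h : R -> R) (x : R) := (\int[mu]_t (frac_kernel al x t * `|h t|)%:E)%E.

Let conv_ge0 (h : R -> R) (x : R) : (0 <= conv h x)%E.
Proof. by apply: integral_ge0 => t _; rewrite lee_fin mulr_ge0. Qed.

Let mKh (h : R -> R) : measurable_fun setT h ->
  measurable_fun setT (fun p : R * R => (frac_kernel al p.1 p.2 * `|h p.2|)%:E).
Proof.
move=> mh; apply/measurable_EFinP; apply: measurable_funM => //.
by apply: measurableT_comp => //; apply: measurableT_comp.
Qed.

Let measurable_conv (h : R -> R) : measurable_fun setT h ->
  measurable_fun setT (conv h).
Proof.
move=> mh; apply: (@measurable_fun_fubini_tonelli_F _ _ _ _ _ mu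
  (fun p : R * R => (frac_kernel al p.1 p.2 * `|h p.2|)%:E)); first exact: mKh.
by move=> p; rewrite lee_fin mulr_ge0.
Qed.

(** After the swap the inner integral is the mass of the kernel in x, which is 1. *)
Let integral_conv (h : R -> R) : measurable_fun setT h ->
  (\int[mu]_x conv h x = \int[mu]_t `|h t|%:E)%E.
Proof.
move=> mh.
rewrite (@fubini_tonelli _ _ _ _ _ mu mu
  (fun p : R * R => (frac_kernel al p.1 p.2 * `|h p.2|)%:E)); last 2 first.
- exact: mKh.
- by move=> p; rewrite lee_fin mulr_ge0.
apply: eq_integral => t _ /=; under eq_integral do rewrite EFinM.
rewrite ge0_integralZr//.
- by rewrite integral_frac_kernel_l// mul1e.
- by apply/measurable_EFinP; exact: (measurable_fun_pair1 t mK2).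
- by move=> x _; rewrite lee_fin K0.
Qed.

(** Triangle inequality for h(t) - h(x) = (g(t) - g(x)) + (h - g)(t) - (h - g)(x), integrated
    against the kernel. *)
Let frac_osc_le (h g : R -> R) (x : R) :
  measurable_fun setT h -> measurable_fun setT g ->
  (frac_osc al h x <= frac_osc al g x + conv (h \- g)%R x + `|h x - g x|%:E)%E.
Proof.
move=> mh mg.
(* By mass 1 the constant |h(x) - g(x)| is itself a kernel integral, so everything fits under one
   integral sign. *)
rewrite -(integral_frac_kernelZ al0 x _ (normr_ge0 (h x - g x))).
have mB (k : R -> R) : measurable_fun setT k ->
    measurable_fun setT (fun t => (frac_kernel al x t * `|k t|)%:E).
  move=> mk; apply/measurable_EFinP; apply: measurable_funM => //.
  exact: measurableT_comp.
have P0 (k : R -> R) t : (0 <= (frac_kernel al x t * `|k t|)%:E)%E.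
  by rewrite lee_fin mulr_ge0.
rewrite -ge0_integralD//; last 3 first.
- by move=> t _; exact: (P0 (fun t => g t - g x)).
- by apply: (mB (fun t => g t - g x)); exact: measurable_funB.
- by apply: (mB (h \- g)); exact: measurable_funB.
rewrite -ge0_integralD//; last 4 first.
- by move=> t _; rewrite adde_ge0 ?(P0 (h \- g)) ?(P0 (fun t => g t - g x)).
- by apply: emeasurable_funD;
    [apply: (mB (fun t => g t - g x))|apply: (mB (h \- g))];
    exact: measurable_funB.
- by move=> t _; exact: (P0 (fun=> h x - g x)).
- exact: (mB (fun=> h x - g x)).
apply: ge0_le_integral_nonmeas => t _; first by rewrite lee_fin mulr_ge0.
rewrite -!EFinD lee_fin -!mulrDr ler_wpM2l//=.
rewrite (_ : h t - h x = (g t - g x) + (h t - g t) - (h x - g x)); last by ring.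
by rewrite (le_trans (ler_normB _ _))// lerD2r ler_normD.
Qed.

(** Integrate [frac_osc_le] over D; the [conv] term is enlarged to the whole line, where
    [integral_conv] evaluates it. *)
Lemma integral_frac_osc_le (D : set R) (h g : R -> R) : measurable D ->
  measurable_fun setT h -> measurable_fun setT g ->
  (\int[mu]_(x in D) frac_osc al h x <= \int[mu]_(x in D) frac_osc al g x +
    \int[mu]_t `|h t - g t|%:E + \int[mu]_(x in D) `|h x - g x|%:E)%E.
Proof.
move=> mD mh mg.
have mhg : measurable_fun setT (h \- g) by exact: measurable_funB.
apply: (@le_trans _ _ (\int[mu]_(x in D)
    (frac_osc al g x + conv (h \- g)%R x + `|h x - g x|%:E))%E).
  apply: ge0_le_integral_nonmeas => x _; first exact: frac_osc_ge0.
  exact: frac_osc_le.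
have mo : measurable_fun D (frac_osc al g).
  by apply: measurable_funTS; exact: measurable_frac_osc.
have mc : measurable_fun D (conv (h \- g)).
  by apply: measurable_funTS; exact: measurable_conv.
rewrite ge0_integralD//; last 3 first.
- by move=> x _; rewrite adde_ge0 ?frac_osc_ge0.
- exact: emeasurable_funD.
- by apply/measurable_EFinP; apply: measurable_funTS; exact: measurableT_comp.
rewrite leeD2r// ge0_integralD//; last by move=> x _; exact: frac_osc_ge0.
rewrite leeD2l// -[leRHS](integral_conv _ mhg).
apply: ge0_subset_integral => //; exact: measurable_conv.
Qed.

End frac_osc_approx.

(** * Oscillation of continuous functions on a segment *)

(** Heine-Cantor through the near-covering form of compactness: a local choice of d near 0^+ at each
    point of [a, b] yields one d for all. *)
Lemma segment_unif_continuous {R : realType} (a b : R) (g : R -> R) (e : R) :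
  continuous g -> 0 < e ->
  exists2 d, 0 < d & forall x t, a <= x <= b -> `|x - t| < d -> `|g t - g x| <= e.
Proof.
move=> cg e0.
have nc x : `[a, b]%classic x -> \forall x' \near x & d \near 0^'+,
    forall t, `|x' - t| < d -> `|g t - g x'| <= e.
  move=> _.
  have /cvgrPdist_le/(_ (e / 2)) := cg x.
  rewrite divr_gt0// => /(_ erefl)/nbhs_ballP[r /= r0 gr].
  (* Halving r keeps both y and t within r of x, where g differs from g(x) by at most e / 2. *)
  exists (ball x (r / 2), [set d | d < r / 2]).
    by split => /=; [apply: nbhsx_ballx|apply: nbhs_right_lt]; rewrite divr_gt0.
  move=> [y d] /= [xy dr] t ytd.
  rewrite /ball/= in xy gr.
  have gy : `|g x - g y| <= e / 2 by apply: gr => /=; lra.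
  have gt_ : `|g x - g t| <= e / 2.
    apply: gr => /=.
    have := ler_distD y x t; lra.
  have := ler_distD (g x) (g t) (g y); rewrite (distrC (g t) (g x)); lra.
have nd := iffLR (compact_near_coveringP _) (@segment_compact R a b) R (0^'+)
  (fun d x => forall t, `|x - t| < d -> `|g t - g x| <= e) _ nc.
have [d [d0 dP]] : exists d : R, 0 < d /\
    `[a, b]%classic `<=` (fun x => forall t, `|x - t| < d -> `|g t - g x| <= e).
  have := @filter_ex _ _ _ _ (filterI (nbhs_right_gt (0 : R)) (nd _)).
  by move=> [d [d0 dP]]; exists d.
by exists d => // x t axb; apply: dP => /=; rewrite in_itv.
Qed.

Section continuous_case.
Context {R : realType}.
Notation mu := (@lebesgue_measure R).
Variables (a b al e d M : R) (g : R -> R).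
Hypotheses (ab : a < b) (al0 : 0 < al) (e0 : 0 <= e) (d0 : 0 < d).
Hypothesis gM : forall x, a <= x <= b -> `|g x| <= M.
Hypothesis g_osc : forall x t, a <= x <= b -> a <= t <= b -> `|x - t| < d ->
  `|g t - g x| <= e.

Let h : R -> R := g \_ `[a, b].

Let M0 : 0 <= M.
Proof. by apply: (le_trans (normr_ge0 (g a))); rewrite gM// lexx ltW. Qed.

Let hin x : a <= x <= b -> h x = g x.
Proof. by move=> axb; rewrite /h patchE mem_set//= in_itv. Qed.

Let hout x : ~ (a <= x <= b) -> h x = 0.
Proof. by move=> axb; rewrite /h patchE memNset//= in_itv. Qed.

Let hM x : `|h x| <= M.
Proof.
have [axb|/negP axb] := boolP (a <= x <= b); first by rewrite hin// gM.
by rewrite hout// normr0.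
Qed.

(** Three cases: t at distance at least d costs 2M; t closer and in [a, b] costs e; t closer but
    below a forces x <= a + d, and the jump costs M. As t < x <= b, the jump at b is never
    crossed. *)
Let h_osc x t : a <= x <= b -> t < x ->
  `|h t - h x| <= e + M * \1_(`[a, a + d]) x + 2 * M * \1_(`]-oo, x - d]) t.
Proof.
move=> axb tx; have /andP[ax xb] := axb.
have [td|td] := leP t (x - d).
  rewrite [\1__ t]indicE mem_set//= ?in_itv//= mulr1.
  rewrite (le_trans (ler_normB _ _))// (le_trans (lerD (hM t) (hM x)))//.
  by rewrite mulr_natl mulr2n lerDr addr_ge0// mulr_ge0.
rewrite [\1__ t]indicE memNset; last by rewrite /= in_itv/= leNgt td.
rewrite mulr0 addr0.
have [at_|ta] := leP a t.
  have atb : a <= t <= b by rewrite at_ (le_trans (ltW tx)).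
  rewrite !hin//; apply: (@le_trans _ _ e); last by rewrite lerDl mulr_ge0.
  by apply: g_osc => //; rewrite gtr0_norm ?subr_gt0//; lra.
rewrite [h t]hout; last by move=> /andP[]; rewrite leNgt ta.
rewrite sub0r normrN indicE mem_set; last by rewrite /= in_itv/= ax/=; lra.
by rewrite mulr1 (le_trans (hM x))// lerDr.
Qed.

(** Integrate [h_osc] in t: the terms constant in t keep their value by mass 1, the far term is
    weighted by the kernel tail. *)
Let osc_le x : a <= x <= b ->
  (frac_osc al h x <=
   (e + 2 * M * expR (- (d / al)) + M * \1_(`[a, a + d]) x)%:E)%E.
Proof.
move=> axb.
have mK : measurable_fun setT (frac_kernel al x).
  exact: (measurable_fun_pair2 x measurable_frac_kernel).
have K0 := frac_kernel_ge0 al0.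
set c := e + M * \1_(`[a, a + d]) x.
have c0 : 0 <= c by rewrite addr_ge0// mulr_ge0.
set T := `]-oo, x - d]%classic.
apply: (@le_trans _ _ (\int[mu]_t ((frac_kernel al x t * c)%:E +
    (2 * M)%:E * ((EFin \o frac_kernel al x) \_ T) t))%E).
  apply: ge0_le_integral_nonmeas => t _; first by rewrite lee_fin mulr_ge0.
  rewrite restrict_EFin/= -EFinM -EFinD lee_fin.
  have -> : (frac_kernel al x \_ T) t = frac_kernel al x t * \1_T t.
    by rewrite patchE indicE; case: ifPn => _; rewrite ?mulr1 ?mulr0.
  (* [h_osc] covers t < x only; for the other t the kernel vanishes. *)
  have [tx|xt] := ltP t x; last by rewrite frac_kernel0// !mul0r mulr0 addr0.
  rewrite mulrCA -mulrDr ler_wpM2l//; exact: h_osc.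
have mKT : measurable_fun setT ((EFin \o frac_kernel al x) \_ T).
  apply: (iffLR (measurable_restrictT (EFin \o frac_kernel al x) _)).
    exact: measurable_itv.
  by apply/measurable_EFinP; apply: measurable_funTS.
have KT0 t : (0 <= ((EFin \o frac_kernel al x) \_ T) t)%E.
  by apply: erestrict_ge0 => ? _; rewrite lee_fin.
rewrite ge0_integralD//; last 4 first.
- by move=> t _; rewrite lee_fin mulr_ge0.
- by apply/measurable_EFinP; exact: measurable_funM.
- by move=> t _; rewrite mule_ge0// lee_fin mulr_ge0.
- exact: measurable_funeM.
rewrite integral_frac_kernelZ// ge0_integralZl//.
2: by rewrite lee_fin mulr_ge0.
rewrite -integral_mkcond.
apply: (@le_trans _ _ (c%:E + (2 * M)%:E * (expR (- (d / al)))%:E)%E).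
  by rewrite leeD2l// lee_wpmul2l ?lee_fin ?mulr_ge0// integral_frac_kernel_tail.
by rewrite -EFinM -EFinD lee_fin /c addrAC.
Qed.

Lemma integral_frac_osc_continuous :
  (\int[mu]_(x in `[a, b]) frac_osc al h x <=
   ((e + 2 * M * expR (- (d / al))) * (b - a) + M * d)%:E)%E.
Proof.
have cM0 : 0 <= e + 2 * M * expR (- (d / al)).
  by rewrite addr_ge0// mulr_ge0 ?expR_ge0// mulr_ge0.
apply: (@le_trans _ _ (\int[mu]_(x in `[a, b])
    ((e + 2 * M * expR (- (d / al)))%:E + M%:E * (\1_(`[a, a + d]) x)%:E))%E).
  apply: ge0_le_integral_nonmeas => x; first by move=> _; exact: frac_osc_ge0.
  by rewrite /= in_itv/= => /osc_le; rewrite EFinD EFinM.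
have mI (D : set R) :
    measurable_fun D (fun x => (\1_(`[a, a + d]) x)%:E : \bar R).
  by apply/measurable_EFinP; exact: measurable_indic.
rewrite ge0_integralD//; last 2 first.
- by move=> x _; rewrite mule_ge0// lee_fin.
- by apply: measurable_funeM; exact: mI.
rewrite integral_cst//= ge0_integralZl//; last exact: mI.
rewrite integral_indic//= lebesgue_measure_itv/= lte_fin ab -EFinB -EFinM EFinD.
rewrite leeD2l// EFinM lee_wpmul2l ?lee_fin//.
(* [a, a + d] may stick out of [a, b], so the jump term is bounded by its full length d. *)
apply: (@le_trans _ _ (mu `[a, a + d])).
  by apply: le_measure; rewrite ?inE//; exact: measurableI.
by rewrite lebesgue_measure_itv/= lte_fin ltrDl d0 -EFinB addrC addKr.
Qed.
End continuous_case.

(** * L1 bound and passage to the limit *)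

Section L1_bound.
Context {R : realType}.
Notation mu := (@lebesgue_measure R).
Variables (a b : R) (f : R -> R).
Hypothesis mf : measurable_fun `[a, b] f.

(** The pointwise bound [frac_int_le_osc] is followed by the exchange of f for g, whose error counts
    twice: averaged by the kernel and at x itself. *)
Lemma L1norm_frac_int_le (al : R) (g : R -> R) :
  0 < al -> measurable_fun setT g ->
  (L1norm a b (frac_int a al f \- f)%R <=
   \int[mu]_(x in `[a, b]) frac_osc al (g \_ `[a, b]) x +
   (\int[mu]_(x in `[a, b]) `|(f x - g x)%:E| +
    \int[mu]_(x in `[a, b]) `|(f x - g x)%:E|))%E.
Proof.
move=> al0 mg; rewrite /L1norm Lnorm1.
rewrite (_ : (\int[mu]_x _ = \int[mu]_(x in `[a, b])
    `|(frac_int a al f x - f x)%:E|)%E); last first.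
  rewrite [RHS]integral_mkcond; apply: eq_integral => x _.
  by rewrite !patchE; case: ifPn => //= _; rewrite normr0.
have mh : measurable_fun setT (f \_ `[a, b]).
  by apply: (iffLR (measurable_restrictT f _) mf).
have mk : measurable_fun setT (g \_ `[a, b]).
  apply: (iffLR (measurable_restrictT g _)); first exact: measurable_itv.
  exact: measurable_funTS.
apply: (@le_trans _ _ (\int[mu]_(x in `[a, b]) frac_osc al (f \_ `[a, b]) x)%E).
  apply: ge0_le_integral_nonmeas => x; first by rewrite lee_fin.
  by rewrite /= in_itv/=; exact: frac_int_le_osc.
apply: (le_trans (integral_frac_osc_le al0 _ _ _ (measurable_itv _) mh mk)).
rewrite -addeA leeD2l// leeD//.
  rewrite [leRHS]integral_mkcond; apply: ge0_le_integral_nonmeas => x _ //.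
  by rewrite !patchE; case: ifPn => //= _; rewrite subrr normr0.
apply: ge0_le_integral_nonmeas => x //= axb.
by rewrite !patchE mem_set.
Qed.
End L1_bound.

Lemma near_L1norm_frac_int_le {R : realType} (a b : R) (f : R -> R) (e : R) :
  a < b -> (@lebesgue_measure R).-integrable `[a, b] (EFin \o f) -> 0 < e ->
  \forall al \near 0^'+, (L1norm a b (frac_int a al f \- f)%R <= e%:E)%E.
Proof.
move=> ab hf e0; set mu := @lebesgue_measure R.
have mf : measurable_fun `[a, b] f.
  by apply/measurable_EFinP; exact: measurable_int hf.
(* Five contributions of size e': local oscillation, kernel tail, jump at a, and twice the L1
   distance from f to g. *)
set e' := e / 5.
have e'0 : 0 < e' by rewrite divr_gt0.
have [g cg fg] : exists2 g : R -> R, continuous g &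
    (\int[mu]_(x in `[a, b]) `|(f x - g x)%:E| <= e'%:E)%E.
  have fin : (mu `[a, b]%classic < +oo)%E.
    by rewrite /mu lebesgue_measure_itv/= lte_fin ab -EFinB ltry.
  have [g_ [cg _ /fine_cvgP[gfin /cvgrPdist_le/(_ _ e'0) gle]]] :=
    approximation_continuous_integrable (measurable_itv `[a, b]) fin hf.
  have [n [finn len]] := filter_ex (filterI gfin gle).
  exists (g_ n) => //; rewrite -(fineK finn) lee_fin.
  by move: len; rewrite /= sub0r normrN; exact: le_trans (ler_norm _).
have mg : measurable_fun setT g by exact: continuous_measurable_fun.
have [c _ gM] : exists2 c : R, c \in `[a, b]%R &
    forall t : R, t \in `[a, b]%R -> `|g t| <= `|g c|.
  apply: (EVT_max (f := fun x => `|g x|)); first exact: ltW.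
  apply: continuous_subspaceT => x.
  apply: continuous_comp; first exact: cg.
  exact: norm_continuous.
set M := `|g c|.
have M0 : 0 <= M by exact: normr_ge0.
have ba0 : 0 < b - a by rewrite subr_gt0.
(* Dividing by b - a makes the local oscillation integrate to e' over [a, b]. *)
have [d1 d10 gd1] := @segment_unif_continuous R a b g (e' / (b - a)) cg
  (divr_gt0 e'0 ba0).
(* The second bound gives M * d <= e'; M + 1 replaces M, which may be 0. *)
set d := Num.min d1 (e' / (M + 1)).
have M1 : 0 < M + 1 by lra.
have d0 : 0 < d by rewrite lt_min d10 divr_gt0.
(* N exceeds the tail coefficient 2M(b - a) and stays positive; al < d * e' / N then gives N * (al /
   d) <= e'. *)
set N := 2 * M * (b - a) + 1.
have N0 : 0 < N by apply: ltr_wpDl => //; rewrite !mulr_ge0// ltW.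
near=> al.
have al0 : 0 < al by near: al; exact: nbhs_right_gt.
have alle : al < d * e' / N.
  by near: al; apply: nbhs_right_lt; rewrite !divr_gt0 ?mulr_gt0.
apply: (le_trans (@L1norm_frac_int_le R a b f mf al g al0 mg)).
have osc := @integral_frac_osc_continuous R a b al (e' / (b - a)) d M g ab al0
  (ltW (divr_gt0 e'0 ba0)) d0.
apply: (@le_trans _ _ ((e' + e' + e')%:E + (e'%:E + e'%:E))%E); last first.
  by rewrite -!EFinD lee_fin /e'; lra.
rewrite leeD ?leeD//; apply: le_trans (osc _ _) _.
- by move=> x axb; apply: gM; rewrite in_itv.
- move=> x t axb _ xt; apply: gd1 => //; apply: lt_le_trans xt _.
  by rewrite ge_min lexx.
have Md : M * d <= e'.
  apply: (@le_trans _ _ ((M + 1) * (e' / (M + 1)))).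
    by rewrite ler_pM// ?(ltW d0)//; [lra|rewrite ge_min lexx orbT].
  by rewrite mulrC divfK// gt_eqF.
(* Inverse of exp(u) >= 1 + u >= u at u = d / al. *)
have exple : expR (- (d / al)) <= al / d.
  rewrite expRN -[leRHS]invrK lef_pV2 ?posrE ?expR_gt0 ?invr_gt0 ?divr_gt0//.
  rewrite invf_div; have := expR_ge1Dx (d / al); lra.
have tail : 2 * M * expR (- (d / al)) * (b - a) <= e'.
  apply: (@le_trans _ _ (N * (al / d))).
    rewrite mulrAC; apply: ler_pM => //; rewrite ?expR_ge0//.
      by rewrite mulr_ge0 ?(ltW ba0)// mulr_ge0.
    by rewrite /N lerDl.
  by rewrite mulrA ler_pdivrMr// [N * al]mulrC [e' * d]mulrC -ler_pdivlMr// ltW.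
rewrite lee_fin mulrDl divfK ?gt_eqF//; lra.
Unshelve. all: by end_near.
Qed.

Theorem theorem2p4 (R : realType) (a b : R) (f : R -> R) (hab : a < b)
    (hf : (@lebesgue_measure R).-integrable `[a, b] (EFin \o f)) :
  L1norm a b (frac_int a alpha f \- f) @[alpha --> 0^'+] --> 0%E.
Proof.
have L0 al : (0 <= L1norm a b (frac_int a al f \- f)%R)%E by exact: Lnorm_ge0.
have fin al (e : R) : (L1norm a b (frac_int a al f \- f)%R <= e%:E)%E ->
    L1norm a b (frac_int a al f \- f) \is a fin_num.
  by move=> Le; rewrite ge0_fin_numE// (le_lt_trans Le) ?ltry.
(* A limit in the extended reals means eventual finiteness, taken from the bound with e = 1, and
   convergence of the real values. *)
apply/fine_cvgP; split.
  by apply: filterS (near_L1norm_frac_int_le _ _ _ _ hab hf ltr01) => al /fin.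
apply/cvgrPdist_le => e e0.
apply: filterS (near_L1norm_frac_int_le _ _ _ _ hab hf e0) => al Le /=.
by rewrite sub0r normrN ger0_norm ?fine_ge0// -lee_fin fineK// (fin _ _ Le).
Qed.
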